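(* Let $0\le a<b<\infty$ and let $f:[a,b]\rightarrow\mathbb{R}$ be continuous on $[a,b]$ with $f\in L([a,b])$. Let $p,q>0$ be fixed real numbers. If $|f|$ is $P$-convex on $[a,b]$, then $$\int_a^b (x-a)^p(b-x)^q f(x)\,dx\le (b-a)^{p+q+1}\,\beta(p+1,q+1)\,\bigl(|f(a)|+|f(b)|\bigr).$$
   Context: Let $I\subseteq\mathbb{R}$ be an interval. A function $g:I\rightarrow\mathbb{R}$ is called $P$-convex on $I$ if it is nonnegative and $g(tx+(1-t)y)\le g(x)+g(y)$ for all $x,y\in I$ and all $t\in[0,1]$. $L([a,b])$ denotes the space of Lebesgue integrable functions on $[a,b]$. $\beta$ is the Euler Beta function, $\beta(x,y)=\int_0^1 t^{x-1}(1-t)^{y-1}\,dt$ for $x,y>0$. *)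

(* Defs.v *)
From HB Require Import structures.
From mathcomp Require Import all_boot all_order all_algebra.
From mathcomp Require Import all_classical all_reals all_analysis.

Set Implicit Arguments.
Unset Strict Implicit.
Unset Printing Implicit Defensive.

Import Order.TTheory GRing.Theory Num.Theory.
Import numFieldNormedType.Exports.

Local Open Scope ring_scope.

Definition P_convex (R : realType) (I : interval R) (g : R -> R) : Prop :=
  (forall x, x \in I -> 0 <= g x) /\
  (forall x y t, x \in I -> y \in I -> 0 <= t <= 1 ->
     g (t * x + (1 - t) * y) <= g x + g y).

(* Real-parameter Beta function, meaningful for 0 < x and 0 < y; the library's
   beta_fun only takes natural number parameters. *)
Definition Beta (R : realType) (x y : R) : R :=
  \int[@lebesgue_measure R]_(t in `[0, 1]) (t `^ (x - 1) * (1 - t) `^ (y - 1)).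

(* Main.v *)
(** The weight [(x - a)^p (b - x)^q] is nonnegative, and [P]-convexity of [|f|]
    bounds [f x] by [|f a| + |f b|] at every [x = t a + (1 - t) b].  It remains to
    integrate the weight, which the affine substitution [t = (x - a) / (b - a)]
    turns into the Beta integral. *)
Require Import Defs.
From HB Require Import structures.
From mathcomp Require Import all_boot all_order all_algebra.
From mathcomp Require Import all_classical all_reals all_analysis.
From mathcomp Require Import ring.

Import Order.TTheory GRing.Theory Num.Theory.
Import numFieldNormedType.Exports.

Local Open Scope classical_set_scope.
Local Open Scope ring_scope.

(* The norm is needed: [x `^ p] takes the junk value [1] for [x < 0]. *)
Lemma continuous_norm_powR (R : realType) (p : R) :
  0 < p -> continuous (fun x : R => `|x| `^ p).
Proof.
move=> p0 x; have [->|x0] := eqVneq x 0.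
  (* At 0 the function may fail to be differentiable, for instance when p < 1, so continuity is
     proved by hand there: e is the p-th power of e^(1/p), and monotonicity of the power makes
     e^(1/p) a valid radius. *)
  apply/cvgrPdist_lt => e e0; near=> y.
  rewrite normr0 powR0 ?gt_eqF// sub0r normrN ger0_norm ?powR_ge0//.
  have -> : e = (e `^ p^-1) `^ p by rewrite -powRrM mulVf ?gt_eqF// powRr1// ltW.
  rewrite gt0_ltr_powR ?nnegrE ?powR_ge0//.
  near: y; apply: (cvgr0_norm_lt (V := R^o) id) => //; exact: powR_gt0.
apply: (@continuous_comp R R R Num.norm (fun y : R => y `^ p)).
  exact: norm_continuous.
apply: differentiable_continuous; apply/derivable1_diffP.
by apply: derivable_powR; rewrite in_itv/= andbT normr_gt0.
Unshelve. all: by end_near. Qed.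

(** With norms, the weight is continuous on the whole line and still agrees with (x - a)^p (b - x)^q
    on [a, b]. Integrability on segments then follows by compactness, and the substitution below can
    assume global continuity. *)
Lemma continuous_beta_weight (R : realType) (a b p q : R) : 0 < p -> 0 < q ->
  continuous (fun x : R => `|x - a| `^ p * `|b - x| `^ q).
Proof.
move=> p0 q0 x; apply: cvgM.
- apply: (@continuous_comp _ _ _ (fun y : R => y - a) (fun y : R => `|y| `^ p)).
    by apply: cvgB; [exact: cvg_id | exact: cvg_cst].
  exact: continuous_norm_powR.
- apply: (@continuous_comp _ _ _ (fun y : R => b - y) (fun y : R => `|y| `^ q)).
    by apply: cvgB; [exact: cvg_cst | exact: cvg_id].
  exact: continuous_norm_powR.
Qed.

Lemma Rintegral_affine_substitution (R : realType) (a b : R) (G : R -> R) :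
  a < b -> continuous G ->
  \int[@lebesgue_measure R]_(t in `[0, 1]) G t =
  \int[@lebesgue_measure R]_(x in `[a, b]) (G ((x - a) / (b - a)) / (b - a)).
Proof.
move=> ab cG; pose F (x : R) : R := (x - a) / (b - a).
have ba0 : 0 < b - a by rewrite subr_gt0.
have dF (x : R) : is_derive x 1 F (b - a)^-1.
  rewrite /F; apply: is_derive_eq.
  by rewrite scaler0 add0r subr0 /GRing.scale/= mulr1.
have F'E : derive1 F = cst (b - a)^-1.
  by apply/funext => x; rewrite derive1E; exact: derive_val.
have cF : continuous F.
  by move=> x; apply/differentiable_continuous/derivable1_diffP.
have Fa : F a = 0 by rewrite /F subrr mul0r.
have Fb : F b = 1 by rewrite /F divff ?gt_eqF.
(* The real-valued integral is [fine] of the extended-real one, to which the substitution theorem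
   applies. *)
congr fine; have := @integration_by_substitution_increasing R F G a b (ltW ab).
rewrite Fa Fb F'E => ->//.
- by move=> x y _ _ xy; rewrite /F ltr_pM2r ?invr_gt0// ltrD2r.
- by move=> x _; exact: cvg_cst.
- exact: is_cvg_cst.
- exact: is_cvg_cst.
- split => //.
  + by apply: cvg_at_right_filter; exact: cF.
  + by apply: cvg_at_left_filter; exact: cF.
- exact: continuous_subspaceT.
Qed.

Lemma Rintegral_beta_weight (R : realType) (a b p q : R) :
  a < b -> 0 < p -> 0 < q ->
  \int[@lebesgue_measure R]_(x in `[a, b]) (`|x - a| `^ p * `|b - x| `^ q) =
  (b - a) `^ (p + q + 1) * Beta (p + 1) (q + 1).
Proof.
move=> ab p0 q0; have ba0 : 0 < b - a by rewrite subr_gt0.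
have cw := continuous_beta_weight R 0 1 p q p0 q0.
(* The Beta integrand is put in the form of the weight for the segment [0, 1], hence the term
   [t - 0], so that [cw] supplies its continuity. *)
have -> : Beta (p + 1) (q + 1) =
    \int[@lebesgue_measure R]_(t in `[0, 1]) (`|t - 0| `^ p * `|1 - t| `^ q).
  apply: eq_Rintegral => t; rewrite inE/= in_itv/= => /andP[t0 t1].
  by rewrite !addrK subr0 !ger0_norm ?subr_ge0.
rewrite (Rintegral_affine_substitution _ _ _ _ ab cw) -RintegralZl//; last first.
  apply: continuous_compact_integrable; first exact: segment_compact.
  apply: continuous_subspaceT => x; apply: cvgM; last exact: cvg_cst.
  apply: (@continuous_comp _ _ _ (fun y : R => (y - a) / (b - a))
    (fun t : R => `|t - 0| `^ p * `|1 - t| `^ q)); last exact: cw.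
  by apply: cvgM; [apply: cvgB; [exact: cvg_id | exact: cvg_cst] | exact: cvg_cst].
apply: eq_Rintegral => x; rewrite inE/= in_itv/= => /andP[ax xb].
have xa0 : 0 <= x - a by rewrite subr_ge0.
have bx0 : 0 <= b - x by rewrite subr_ge0.
have -> : 1 - (x - a) / (b - a) = (b - x) / (b - a) by field; rewrite gt_eqF.
rewrite subr0 !ger0_norm ?divr_ge0// ?(ltW ba0)//.
have bav0 : 0 <= (b - a)^-1 by rewrite invr_ge0 ltW.
have powV r : (b - a)^-1 `^ r = ((b - a) `^ r)^-1.
  by rewrite -(powR_inv1 (ltW ba0)) powRAC powR_inv1 ?powR_ge0.
(* The factor (b - a)^(p + q + 1) cancels the denominators (b - a)^p and (b - a)^q of the two
   quotients and the Jacobian 1 / (b - a). *)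
rewrite !powRM// !powV !powRD ?(gt_eqF ba0) ?implybT// powRr1 ?ltW//.
by field; rewrite !gt_eqF ?powR_gt0.
Qed.

Lemma P_convex_le_endpoints (R : realType) (a b : R) (g : R -> R) (x : R) :
  a < b -> P_convex `[a, b] g -> x \in `[a, b] -> g x <= g a + g b.
Proof.
move=> ab [_ gP]; rewrite in_itv/= => /andP[ax xb].
have ba0 : 0 < b - a by rewrite subr_gt0.
(* The coefficient of a comes from solving x = t a + (1 - t) b for t. *)
have {1}-> : x = (b - x) / (b - a) * a + (1 - (b - x) / (b - a)) * b.
  by field; rewrite gt_eqF.
apply: gP; rewrite ?in_itv/= ?lexx ?(ltW ab)//.
by rewrite divr_ge0 ?subr_ge0 ?(ltW ab)//= ler_pdivrMr// mul1r lerB.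
Qed.

Theorem theorem2p1 (R : realType) (a b : R) (f : R -> R) (p q : R)
  (ha : 0 <= a) (hab : a < b)
  (hfc : {within `[a, b], continuous f})
  (hfi : (@lebesgue_measure R).-integrable `[a, b] (EFin \o f))
  (hp : 0 < p) (hq : 0 < q)
  (hP : P_convex `[a, b] (fun x => `|f x|)) :
  \int[@lebesgue_measure R]_(x in `[a, b])
     ((x - a) `^ p * (b - x) `^ q * f x)
  <= (b - a) `^ (p + q + 1) * Beta (p + 1) (q + 1) * (`|f a| + `|f b|).
Proof.
have cw := continuous_beta_weight R a b p q hp hq.
have intw : (@lebesgue_measure R).-integrable `[a, b]
    (EFin \o (fun x => `|x - a| `^ p * `|b - x| `^ q)).
  apply: continuous_compact_integrable; first exact: segment_compact.
  exact: continuous_subspaceT.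
(* Once the bound is itself an integral over [a, b], with the constant under the integral sign, a
   pointwise comparison suffices. *)
rewrite -Rintegral_beta_weight// -RintegralZr//.
rewrite [leLHS](_ : _ = \int[@lebesgue_measure R]_(x in `[a, b])
    (`|x - a| `^ p * `|b - x| `^ q * f x)); last first.
  apply: eq_Rintegral => x; rewrite inE/= in_itv/= => /andP[ax xb].
  by rewrite !ger0_norm ?subr_ge0.
apply: le_Rintegral => //.
- apply: continuous_compact_integrable; first exact: segment_compact.
  (* Since f is continuous only within [a, b], the global continuity of the weight is restricted to
     the segment before taking the product. *)
  apply/subspace_continuousP => x abx; apply: cvgM.
    by apply: cvg_within_filter; exact: cw.
  by move/subspace_continuousP : hfc; exact.
- apply: continuous_compact_integrable; first exact: segment_compact.
  apply: continuous_subspaceT => x; apply: cvgM; [exact: cw|exact: cvg_cst].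
- move=> x abx; apply: ler_wpM2l; first by rewrite mulr_ge0 ?powR_ge0.
  apply: le_trans (ler_norm _) _.
  exact: (P_convex_le_endpoints R a b (fun y => `|f y|)).
Qed.
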